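(* For every $x>0$ and every $0\leq r\leq 1$, $$K(x)^r\geq K(x^r),$$ where $K$ denotes the Kantorovich constant.
   Context: The Kantorovich constant is the function $K:(0,\infty)\to(0,\infty)$ defined by $K(x)=\dfrac{(x+1)^2}{4x}$. *)

(* Defs.v *)
From Stdlib Require Import Reals.
Open Scope R_scope.

(* The Kantorovich constant has domain (0, +oo); values of this total
   function at x <= 0 are irrelevant. *)
Definition kantorovich (x : R) : R := (x + 1) ^ 2 / (4 * x).

(* Main.v *)
Require Import Defs.
From Stdlib Require Import Reals.
From Stdlib Require Import Lra.
Open Scope R_scope.

(* Multiplying by [x^r] and taking square roots, the claim becomes
    [(x^r + 1) / 2 <= m^r] with [m = (x + 1) / 2], a case of the concavity of
    [u^r]. It follows by adding Bernoulli's inequality [u^r <= 1 + r (u - 1)]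
    at [u = x / m] and at [u = 1 / m]. *)

Lemma ln_le_sub1 (u : R) : 0 < u -> ln u <= u - 1.
Proof.
  intros hu. pose proof (exp_ineq1_le (ln u)) as h.
  rewrite exp_ln in h by assumption. lra.
Qed.

(* Concavity of [ln]: the weights [r], [1 - r] are applied to the tangent bound
   [ln y <= y - 1] at [y = u / v] and [y = 1 / v], where [v = 1 + r (u - 1)]. *)
Lemma Rpower_bernoulli_le (u r : R) :
  0 < u -> 0 <= r <= 1 -> Rpower u r <= 1 + r * (u - 1).
Proof.
  intros hu hr. set (v := 1 + r * (u - 1)).
  (* If [u <= 1] then [v >= u]; otherwise [v >= 1]. *)
  assert (hv : 0 < v) by (unfold v; destruct (Rle_dec u 1); nra).
  assert (hv' : 0 < / v) by (apply Rinv_0_lt_compat; lra).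
  pose proof (ln_le_sub1 (u * / v) ltac:(nra)) as h1.
  pose proof (ln_le_sub1 (/ v) hv') as h2.
  rewrite ln_mult, ln_Rinv in h1 by assumption.
  rewrite ln_Rinv in h2 by assumption.
  (* Since [r * u + (1 - r) = v], the weighted right-hand sides of [h1] and [h2] cancel; the
     left-hand sides leave [r * ln u - ln v]. *)
  assert (e : r * (u * / v - 1) + (1 - r) * (/ v - 1) = 0).
  { replace (r * (u * / v - 1) + (1 - r) * (/ v - 1)) with (v * / v - 1)
      by (unfold v at 1; ring).
    rewrite Rinv_r; lra. }
  assert (hl : r * ln u <= ln v) by nra.
  unfold Rpower. rewrite <- (exp_ln v hv) at 1.
  destruct hl as [hl | ->]; [left; now apply exp_increasing | lra].
Qed.

(** After scaling by the midpoint [m], the points [x / m] and [y / m] average to 1, so the linear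
    terms of the two Bernoulli bounds cancel. *)
Lemma Rpower_midpoint_concave (x y r : R) :
  0 < x -> 0 < y -> 0 <= r <= 1 ->
  (Rpower x r + Rpower y r) / 2 <= Rpower ((x + y) / 2) r.
Proof.
  intros hx hy hr. set (m := (x + y) / 2).
  assert (hm : 0 < m) by (unfold m; lra).
  assert (hpos : forall a, 0 < a -> 0 < a / m)
    by (intros; now apply Rdiv_lt_0_compat).
  assert (hsplit : forall a, 0 < a -> Rpower a r = Rpower m r * Rpower (a / m) r).
  { intros a ha. rewrite Rpower_mult_distr by auto. f_equal. field; lra. }
  pose proof (Rpower_bernoulli_le (x / m) r (hpos x hx) hr) as h1.
  pose proof (Rpower_bernoulli_le (y / m) r (hpos y hy) hr) as h2.
  assert (e : x / m + y / m = 2) by (unfold m; field; lra).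
  rewrite (hsplit x hx), (hsplit y hy).
  assert (hM : 0 < Rpower m r) by apply exp_pos.
  assert (hs : Rpower (x / m) r + Rpower (y / m) r <= 2) by nra.
  nra.
Qed.

(** A product of positive factors, over which [Rpower] distributes. *)
Lemma kantorovich_midpoint (x : R) :
  0 < x -> kantorovich x = (x + 1) / 2 * ((x + 1) / 2) * / x.
Proof. intros hx. unfold kantorovich. field. lra. Qed.

Theorem mainTheorem4 (x r : R) (hx : 0 < x) (hr : 0 <= r <= 1) :
  Rpower (kantorovich x) r >= kantorovich (Rpower x r).
Proof.
  assert (hX : 0 < Rpower x r) by apply exp_pos.
  assert (hi : 0 < / x) by now apply Rinv_0_lt_compat.
  assert (hm : 0 < (x + 1) / 2) by lra.
  assert (einv : Rpower (/ x) r = / Rpower x r).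
  { unfold Rpower. rewrite ln_Rinv by assumption.
    rewrite <- exp_Ropp. f_equal. ring. }
  pose proof (Rpower_midpoint_concave x 1 r hx Rlt_0_1 hr) as h.
  replace (Rpower 1 r) with 1 in h
    by (unfold Rpower; now rewrite ln_1, Rmult_0_r, exp_0).
  rewrite !kantorovich_midpoint by assumption.
  rewrite <- !Rpower_mult_distr, einv by nra.
  (* Both sides share the factor [/ Rpower x r]; what remains is [h] multiplied by itself. *)
  apply Rle_ge, Rmult_le_compat_r.
  - left; now apply Rinv_0_lt_compat.
  - apply Rmult_le_compat; lra.
Qed.
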